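(* Let $g\ge1$ and let $C/\mathbb{Q}$ be the hyperelliptic curve of genus $g$ defined by $$y^2+f(x)\,y+x^d=0,$$ where $f(x)\in\mathbb{Q}[x]$ and one of the following holds: (a) $d=2g+1$ and $f(x)=b_gx^g+\dots+b_1x+b_0$; (b) $d=2g+2$ and $f(x)=2x^{g+1}+b_gx^g+\dots+b_1x+b_0$ with $b_g\neq0$; and where $t(x)=-x^d+f(x)^2/4$ has no multiple roots (so in particular $b_0\ne 0$). Let $m_1,\dots,m_k$ be the irreducible factors in $\mathbb{Q}[x]$ (up to multiplication by $\mathbb{Q}^*$) of $t(x)$, and for $1\le j\le k$ let $M_j\in K_2^T(C)/\mathrm{torsion}$ be the class of $\bigl\{\frac{y^2}{x^d},\frac{m_j(x)}{m_j(0)}\bigr\}$. Then: (1) If $f(0)=\pm1$, then the class $\mathbb{M}$ in $K_2^T(C)/\mathrm{torsion}$ of $\{-f(0)y,-x\}$ satisfies $$2d\,\mathbb{M}=\sum_{j=1}^kM_j.$$ (2) If $d=2g+2$, so that $4t(x)=(f(x)-2x^{g+1})(f(x)+2x^{g+1})$, and $$f(x)-2x^{g+1}=m_1\cdots m_l,\qquad f(x)+2x^{g+1}=m_{l+1}\cdots m_k$$ with the $m_j$ irreducible, then the corresponding classes $M_j$ satisfy $$M_1+\dots+M_l=M_{l+1}+\dots+M_k$$ in $K_2^T(C)/\mathrm{torsion}$.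
   Context: The curve $C$ is the non-singular projective model over $\mathbb{Q}$ of the given affine equation; it is isomorphic to the hyperelliptic curve $y^2=t(x)$ with $\deg t=2g+1$. For a field $F$, $K_2(F)=F^*\otimes_{\mathbb{Z}}F^*/\langle a\otimes(1-a): a\in F,\ a\ne 0,1\rangle$, written additively; $\{a,b\}$ denotes the class of $a\otimes b$. For $x\in C(\overline{\mathbb{Q}})$, the tame symbol at $x$ is the homomorphism $T_x:K_2(\mathbb{Q}(C))\to\overline{\mathbb{Q}}^*$, $$T_x(\{a,b\})=(-1)^{\mathrm{ord}_x(a)\,\mathrm{ord}_x(b)}\,\frac{a^{\mathrm{ord}_x(b)}}{b^{\mathrm{ord}_x(a)}}(x),$$ and $K_2^T(C)$ is the subgroup of all $\alpha\in K_2(\mathbb{Q}(C))$ with $T_x(\alpha)=1$ for all $x\in C(\overline{\mathbb{Q}})$. The elements $\{y^2/x^d,\,m_j(x)/m_j(0)\}$ lie in $K_2^T(C)$, and so does $\{-f(0)y,-x\}$ when $f(0)=\pm1$. *)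

(* Defs.v *)
From HB Require Import structures.
From mathcomp Require Import all_boot all_order all_algebra all_field.
From mathcomp Require Import generic_quotient ring_quotient boolp.
From mathcomp Require Import zify ring.
From mathcomp.multinomials Require Import freeg.

Set Implicit Arguments.
Unset Strict Implicit.
Unset Printing Implicit Defensive.

Import Order.TTheory GRing.Theory Num.Theory.
Local Open Scope ring_scope.
Local Open Scope quotient_scope.

Section ModTorsion.
Variable A : zmodType.

Definition torsion : {pred A} := fun a => `[< exists2 n, (0 < n)%N & a *+ n = 0 >].

Fact torsion_zmod_closed : zmod_closed torsion.
Proof.
split=> [|a b /asboolP[n n0 an] /asboolP[p p0 bp]].
  by apply/asboolP; exists 1%N.
apply/asboolP; exists (n * p)%N; first by rewrite muln_gt0 n0.
by rewrite mulrnBl mulrnA an mul0rn mulnC mulrnA bp mul0rn subrr.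
Qed.
HB.instance Definition _ := GRing.isZmodClosed.Build A torsion torsion_zmod_closed.

Definition mod_torsion := {ideal_quot torsion}.
HB.instance Definition _ := GRing.Zmodule.on mod_torsion.

Definition class_mod_torsion (a : A) : mod_torsion := \pi_({ideal_quot torsion}) a.

End ModTorsion.

Section K2.
Variable F : fieldType.

Definition nzelt : Type := {a : F | a != 0}.
HB.instance Definition _ := Choice.on nzelt.

(* For a = 0 this returns 1. *)
Definition nz (a : F) : nzelt := insubd (exist _ 1 (oner_neq0 F)) a.

(* The subgroup of the free abelian group on F^* x F^* by which one divides:
   the first two families of generators give the tensor product of F^* with
   itself over Z, the third one the Steinberg relations. *)
Inductive K2_rel : {freeg (nzelt * nzelt)} -> Prop :=
| K2_rel_mull (a b c : nzelt) :
    K2_rel (<< (nz (val a * val b), c) >> - << (a, c) >> - << (b, c) >>)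
| K2_rel_mulr (a b c : nzelt) :
    K2_rel (<< (a, nz (val b * val c)) >> - << (a, b) >> - << (a, c) >>)
| K2_rel_steinberg (a : F) : a != 0 -> a != 1 ->
    K2_rel << (nz a, nz (1 - a)) >>
| K2_rel0 : K2_rel 0
| K2_relB D E : K2_rel D -> K2_rel E -> K2_rel (D - E).

Definition K2_rels : {pred {freeg (nzelt * nzelt)}} := fun D => `[< K2_rel D >].

Fact K2_rels_zmod_closed : zmod_closed K2_rels.
Proof.
split=> [|D E /asboolP hD /asboolP hE]; first exact/asboolP/K2_rel0.
exact/asboolP/K2_relB.
Qed.
HB.instance Definition _ :=
  GRing.isZmodClosed.Build _ K2_rels K2_rels_zmod_closed.

Definition K2 := {ideal_quot K2_rels}.
HB.instance Definition _ := GRing.Zmodule.on K2.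

(* The class {a, b}; meaningful when a and b are nonzero. *)
Definition symbol (a b : F) : K2 := \pi_({ideal_quot K2_rels}) << (nz a, nz b) >>.

End K2.

(* The points over the algebraic closure algC of Q of the non-singular
   projective curve over Q with function field F: such a point is a discrete
   valuation ring of F (the local ring at the underlying closed point) together
   with an embedding of its residue field in algC.  Here ord is the normalized
   valuation and eval is the reduction, i.e. evaluation of functions at the
   point.  The values ord 0, and eval a when a has a pole, are irrelevant.
   Constants in Q have order 0, since eval maps nonzero integers to nonzero
   algebraic numbers.  As Q has characteristic 0, ord is also the order of
   vanishing at the point on the curve base changed to algC. *)
Record point (F : fieldType) := Point {
  ord : F -> int;
  eval : F -> algC;
  ordM : forall a b, a != 0 -> b != 0 -> ord (a * b) = ord a + ord b;
  ordD : forall a b, a != 0 -> b != 0 -> a + b != 0 ->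
    Num.min (ord a) (ord b) <= ord (a + b);
  ord_uniformizer : exists2 a, a != 0 & ord a = 1;
  regular := fun a => (a == 0) || (0 <= ord a);
  evalD : forall a b, regular a -> regular b -> eval (a + b) = eval a + eval b;
  evalM : forall a b, regular a -> regular b -> eval (a * b) = eval a * eval b;
  eval1 : eval 1 = 1;
  eval_eq0 : forall a, a != 0 -> 0 <= ord a -> (eval a == 0) = (0 < ord a)
}.

Section Tame.
Variables (F : fieldType) (P : point F).

Definition tame_formula (a b : F) : algC :=
  (-1) ^ (ord P a * ord P b) * eval P (a ^ ord P b / b ^ ord P a).

Definition tame_free (D : {freeg (nzelt F * nzelt F)}) : algC :=
  \prod_(p <- dom D) tame_formula (val p.1) (val p.2) ^ coeff p D.

(* By tame_pi below this does not depend on the representative. *)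
Definition tame (alpha : K2 F) : algC := tame_free (repr alpha).

Let ord1 : ord P 1 = 0.
Proof.
by apply: (addrI (ord P 1)); rewrite addr0 -ordM ?oner_neq0 ?mulr1.
Qed.

Let ordV (a : F) : a != 0 -> ord P a^-1 = - ord P a.
Proof.
by move=> a0; apply/eqP; rewrite -addr_eq0 -ordM ?invr_eq0 // mulVf // ord1.
Qed.

Let ordX (a : F) (n : nat) : a != 0 -> ord P (a ^+ n) = ord P a *+ n.
Proof.
move=> a0; elim: n => [|n IH]; first by rewrite expr0 ord1 mulr0n.
by rewrite exprS ordM ?expf_neq0 // IH mulrS.
Qed.

Let ordXz (a : F) (n : int) : a != 0 -> ord P (a ^ n) = ord P a * n.
Proof.
move=> a0; case: n => n; first by rewrite -exprnP ordX // -mulr_natr natz.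
by rewrite NegzE -invr_expz ordV ?expf_neq0 // -exprnP ordX // mulrN -mulr_natr natz.
Qed.

Let eval_neq0 (a : F) : a != 0 -> ord P a = 0 -> eval P a != 0.
Proof. by move=> a0 ha; rewrite eval_eq0 ?ha ?lexx ?ltxx. Qed.

Let eval0M (a b : F) : ord P a = 0 -> ord P b = 0 -> eval P (a * b) = eval P a * eval P b.
Proof. by move=> ha hb; rewrite evalM // /regular ?ha ?hb lexx orbT. Qed.

Let eval0 : eval P 0 = 0.
Proof.
by apply: (addrI (eval P 0)); rewrite -evalD /regular ?eqxx // !addr0.
Qed.

Let m1_neq0 : (-1 : F) != 0. Proof. by rewrite oppr_eq0 oner_neq0. Qed.

Let ordm1 : ord P (-1) = 0.
Proof.
have : ord P (-1) + ord P (-1) = 0 by rewrite -ordM // mulrNN mulr1 ord1.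
by move/eqP; rewrite -mulr2n mulrn_eq0 /= => /eqP.
Qed.

Let ordN (a : F) : a != 0 -> ord P (- a) = ord P a.
Proof. by move=> a0; rewrite -mulN1r ordM // ordm1 add0r. Qed.

Let evalm1 : eval P (-1) = -1.
Proof.
have h : regular P (-1) by rewrite /regular ordm1 lexx orbT.
have h1 : regular P 1 by rewrite /regular ord1 lexx orbT.
by apply/eqP; rewrite -addr_eq0; have := evalD h h1; rewrite addNr eval0 eval1 => <-.
Qed.

Let eval_pos (a : F) : a != 0 -> 0 < ord P a -> eval P a = 0.
Proof. by move=> a0 ha; apply/eqP; rewrite eval_eq0 ?(ltW ha). Qed.

Let evalX (a : F) (n : nat) : ord P a = 0 -> a != 0 -> eval P (a ^+ n) = eval P a ^+ n.
Proof.
move=> ha a0; elim: n => [|n IH]; first by rewrite !expr0 eval1.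
by rewrite !exprS eval0M ?IH // ordX // ha mul0rn.
Qed.

Let evalV (a : F) : ord P a = 0 -> a != 0 -> eval P a^-1 = (eval P a)^-1.
Proof.
move=> ha a0; apply: (mulfI (eval_neq0 a0 ha)).
by rewrite -eval0M ?ordV ?ha ?oppr0 // !mulfV ?eval1 ?eval_neq0.
Qed.

Let evalXz (a : F) (n : int) : ord P a = 0 -> a != 0 -> eval P (a ^ n) = eval P a ^ n.
Proof.
move=> ha a0; case: n => n; first by rewrite -!exprnP evalX.
rewrite NegzE -!invr_expz -!exprnP evalV ?evalX ?expf_neq0 //.
by rewrite ordX // ha mul0rn.
Qed.

Let ord_quot (a b : F) : a != 0 -> b != 0 -> ord P (a ^ ord P b / b ^ ord P a) = 0.
Proof.
move=> a0 b0; rewrite ordM ?invr_eq0 ?expfz_neq0 // ordV ?expfz_neq0 //.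
by rewrite !ordXz // mulrC subrr.
Qed.

Let quot_neq0 (a b : F) : a != 0 -> b != 0 -> a ^ ord P b / b ^ ord P a != 0.
Proof. by move=> a0 b0; rewrite mulf_neq0 ?invr_eq0 ?expfz_neq0. Qed.

Let sgn_neq0 (n : int) : (-1 : algC) ^ n != 0.
Proof. by rewrite expfz_neq0 // oppr_eq0 oner_neq0. Qed.

Lemma tame_formula_neq0 (a b : F) : a != 0 -> b != 0 -> tame_formula a b != 0.
Proof.
move=> a0 b0; rewrite mulf_neq0 // eval_neq0 ?quot_neq0 ?ord_quot //.
Qed.

Lemma tame_formulaMl (a b c : F) : a != 0 -> b != 0 -> c != 0 ->
  tame_formula (a * b) c = tame_formula a c * tame_formula b c.
Proof.
move=> a0 b0 c0; rewrite /tame_formula mulrACA -expfzDr ?oppr_eq0 ?oner_neq0 //.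
rewrite -eval0M ?ord_quot // ordM // mulrDl; congr (_ * eval P _).
by rewrite expfzDr // invfM mulrACA expfzMl.
Qed.

Lemma tame_formulaMr (a b c : F) : a != 0 -> b != 0 -> c != 0 ->
  tame_formula a (b * c) = tame_formula a b * tame_formula a c.
Proof.
move=> a0 b0 c0; rewrite /tame_formula mulrACA -expfzDr ?oppr_eq0 ?oner_neq0 //.
rewrite -eval0M ?ord_quot // ordM // mulrDr; congr (_ * eval P _).
by rewrite expfzDr // expfzMl invfM mulrACA.
Qed.

Let ord_addr (a b : F) : a != 0 -> b != 0 -> a + b != 0 ->
  ord P a < ord P b -> ord P (a + b) = ord P a.
Proof.
move=> a0 b0 ab0 lt_ab; apply/eqP; rewrite eq_le; apply/andP; split; last first.
  by have := ordD P a0 b0 ab0; rewrite (min_idPl (ltW lt_ab)).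
have nb0 : - b != 0 by rewrite oppr_eq0.
have := ordD P ab0 nb0; rewrite addrK => /(_ a0).
by rewrite ordN // ge_min [ord P b <= _]leNgt lt_ab orbF.
Qed.

Lemma tame_formula_steinberg (a : F) : a != 0 -> a != 1 -> tame_formula a (1 - a) = 1.
Proof.
move=> a0 a1.
have b0 : 1 - a != 0 by rewrite subr_eq0 eq_sym.
have na0 : - a != 0 by rewrite oppr_eq0.
have evB : 0 <= ord P a -> eval P (1 - a) = 1 - eval P a.
  move=> ha; rewrite evalD ?eval1 /regular ?ord1 ?lexx ?orbT ?ordN ?ha ?orbT //.
  by rewrite -mulN1r evalM ?evalm1 ?mulN1r // /regular ?ordm1 ?ha ?lexx orbT.
case: (ltgtP (ord P a) 0) => ha.
- have hb : ord P (1 - a) = ord P a.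
    by rewrite addrC ord_addr ?oner_neq0 ?ordN ?ord1 // addrC.
  have q0 : ord P (a / (1 - a)) = 0 by rewrite ordM ?invr_eq0 // ordV // hb subrr.
  have evq : eval P (a / (1 - a)) = -1.
    have -> : a / (1 - a) = -1 + (1 - a)^-1.
      by apply: (mulIf b0); rewrite divfK // mulrDl mulVf // mulN1r opprB subrK.
    have hv : 0 < ord P (1 - a)^-1 by rewrite ordV // hb oppr_gt0.
    rewrite evalD ?evalm1 ?eval_pos ?invr_eq0 ?addr0 //.
      by rewrite /regular ordm1 lexx orbT.
    by rewrite /regular (ltW hv) orbT.
  have -> : tame_formula a (1 - a) =
      (-1) ^ (ord P a * ord P a) * eval P (a / (1 - a)) ^ ord P a.
    by rewrite -evalXz ?mulf_neq0 ?invr_eq0 // /tame_formula hb expfzMl exprz_inv invr_expz.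
  rewrite evq -exprz_exp; set s := (-1) ^ ord P a.
  have : (s - 1) * (s + 1) = 0.
    by rewrite -subr_sqr_1 expr2 /s -expfzMl mulrNN mulr1 exp1rz subrr.
  move/eqP; rewrite mulf_eq0 subr_eq0 addr_eq0 => /orP[] /eqP sE.
    by rewrite sE exp1rz mulr1.
  by rewrite sE -/s sE mulrNN mulr1.
- have hb : ord P (1 - a) = 0.
    by rewrite ord_addr ?oner_neq0 ?ordN ?ord1.
  have h1 : eval P (1 - a) = 1 by rewrite evB ?(ltW ha) // (eval_pos a0 ha) subr0.
  rewrite /tame_formula hb mulr0 !expr0z !mul1r evalV ?ordXz ?hb ?mul0r //; last first.
    by rewrite expfz_neq0.
  by rewrite evalXz // h1 exp1rz invr1.
- have hb : 0 <= ord P (1 - a).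
    have := ordD P (oner_neq0 F) na0 b0.
    by rewrite ordN // ord1 ha minxx.
  rewrite /tame_formula ha mul0r !expr0z mul1r divr1 evalXz //.
  case: (eqVneq (ord P (1 - a)) 0) => [->|nb]; first by rewrite expr0z.
  have : eval P (1 - a) = 0 by rewrite eval_pos // lt_neqAle eq_sym nb.
  by rewrite evB ?ha // => /eqP; rewrite subr_eq0 => /eqP <-; rewrite exp1rz.
Qed.

Let gen_neq0 (p : nzelt F * nzelt F) (n : int) :
  tame_formula (val p.1) (val p.2) ^ n != 0.
Proof. by rewrite expfz_neq0 // tame_formula_neq0 ?(valP p.1) ?(valP p.2). Qed.

Let tame_free_sub (D : {freeg (nzelt F * nzelt F)}) s :
  uniq s -> {subset dom D <= s} ->
  tame_free D = \prod_(p <- s) tame_formula (val p.1) (val p.2) ^ coeff p D.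
Proof.
move=> us sD; rewrite /tame_free [RHS](bigID (mem (dom D))) /=.
rewrite [X in _ * X]big1 ?mulr1 => [|p /coeff_outdom -> //].
rewrite -[RHS]big_filter; apply/perm_big/uniq_perm => [||p].
- exact: uniq_dom.
- exact: filter_uniq.
- by rewrite mem_filter; case: (boolP (p \in dom D)) => //= /sD ->.
Qed.

Lemma tame_freeB D E : tame_free (D - E) = tame_free D / tame_free E.
Proof.
pose s := undup (dom D ++ dom E); have us : uniq s := undup_uniq _.
have sub : {subset dom D ++ dom E <= s} by move=> p; rewrite mem_undup.
rewrite (tame_free_sub us) => [|p /domB /sub //].
rewrite (@tame_free_sub D s us) => [|p pD]; last by rewrite sub // mem_cat pD.
rewrite (@tame_free_sub E s us) => [|p pE]; last by rewrite sub // mem_cat pE orbT.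
rewrite -prodf_div; apply: eq_bigr => p _.
by rewrite coeffB expfzDr ?tame_formula_neq0 ?(valP p.1) ?(valP p.2) // invr_expz.
Qed.

Lemma tame_freeU p : tame_free << p >> = tame_formula (val p.1) (val p.2).
Proof. by rewrite /tame_free domU1 big_seq1 coeffU eqxx mulr1 expr1z. Qed.

Lemma nzK (a : F) : a != 0 -> val (nz a) = a.
Proof. by move=> a0; rewrite /nz insubdK. Qed.

Let tame_free_rel D : K2_rel D -> tame_free D = 1.
Proof.
have tn0 (a b : nzelt F) : tame_formula (val a) (val b) != 0.
  by rewrite tame_formula_neq0 ?(valP a) ?(valP b).
elim=> [a b c|a b c|a a0 a1||D1 E1 _ h1 _ h2].
- rewrite !tame_freeB !tame_freeU /= nzK ?mulf_neq0 ?(valP a) ?(valP b) //.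
  rewrite tame_formulaMl ?(valP a) ?(valP b) ?(valP c) //.
  by rewrite -mulrA -invfM mulfV // mulf_neq0 // tn0.
- rewrite !tame_freeB !tame_freeU /= nzK ?mulf_neq0 ?(valP c) ?(valP b) //.
  rewrite tame_formulaMr ?(valP a) ?(valP b) ?(valP c) //.
  by rewrite -mulrA -invfM mulfV // mulf_neq0 // tn0.
- rewrite tame_freeU /= !nzK ?tame_formula_steinberg //.
  by rewrite subr_eq0 eq_sym.
- by rewrite /tame_free dom0 big_nil.
- by rewrite tame_freeB h1 h2 divr1.
Qed.

Let tame_free_neq0 D : tame_free D != 0.
Proof. by rewrite /tame_free prodf_seq_neq0; apply/allP => p _; apply: gen_neq0. Qed.

Lemma tame_pi D : tame (\pi_({ideal_quot (@K2_rels F)}) D) = tame_free D.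
Proof.
have : repr (\pi_({ideal_quot (@K2_rels F)}) D) - D \in @K2_rels F.
  by rewrite Quotient.idealrBE reprK.
move/asboolP/tame_free_rel; rewrite tame_freeB /tame => h.
by rewrite -[LHS](divfK (tame_free_neq0 D)) h mul1r.
Qed.

Lemma tame_symbol (a b : F) : a != 0 -> b != 0 ->
  tame (symbol a b) = tame_formula a b.
Proof. by move=> a0 b0; rewrite tame_pi tame_freeU !nzK. Qed.

Lemma tameB alpha beta : tame (alpha - beta) = tame alpha / tame beta.
Proof.
elim/quotW: alpha => D; elim/quotW: beta => E.
by rewrite -raddfB !tame_pi tame_freeB.
Qed.

Lemma tame0 : tame 0 = 1.
Proof. by rewrite -(subrr 0) tameB divff //; apply: tame_free_neq0. Qed.

End Tame.

Section K2T.
Variable F : fieldType.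

Definition tame_kernel : {pred K2 F} :=
  fun alpha => `[< forall P : point F, tame P alpha = 1 >].

Fact tame_kernel_zmod_closed : zmod_closed tame_kernel.
Proof.
split=> [|a b /asboolP ha /asboolP hb]; apply/asboolP => P; first exact: tame0.
by rewrite tameB ha hb divr1.
Qed.
HB.instance Definition _ :=
  GRing.isZmodClosed.Build _ tame_kernel tame_kernel_zmod_closed.

Record K2T := MkK2T { K2Tval :> K2 F; _ : K2Tval \in tame_kernel }.
HB.instance Definition _ := [isSub for K2Tval].
HB.instance Definition _ := [Choice of K2T by <:].
HB.instance Definition _ := [SubChoice_isSubZmodule of K2T by <:].

(* alpha lies in the subgroup K2T and c is its class modulo torsion. *)
Definition has_class (alpha : K2 F) (c : mod_torsion K2T) :=
  exists2 a : K2T, K2Tval a = alpha & class_mod_torsion a = c.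

End K2T.

Section Curve.
Variables (g d : nat) (f : {poly rat}).

(* size f = deg f + 1; in the second case f = 2 x^(g+1) + b_g x^g + ... *)
Definition curve_shape : Prop :=
  (d = (2 * g + 1)%N /\ (size f <= g.+1)%N) \/
  [/\ d = (2 * g + 2)%N, size f = g.+2, f`_g.+1 = 2 & f`_g != 0].

Definition t_poly : {poly rat} := - 'X^d + 4^-1 *: f ^+ 2.

(* Y^2 + f(x) Y + x^d over Q(x) *)
Definition curve_poly : {poly {fraction {poly rat}}} :=
  'X^2 + (tofrac f)%:P * 'X + (tofrac 'X^d)%:P.

Lemma size_t_poly : curve_shape -> size t_poly = (2 * g + 2)%N.
Proof.
rewrite /t_poly; case=> [[-> sf]|[-> sf lf nf]].
  rewrite size_polyDl size_polyN size_polyXn ?addn2 ?addn1 //.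
  rewrite (leq_ltn_trans (size_scale_leq _ _)) // (leq_ltn_trans (size_poly_exp_leq _ _)) //.
  by move: sf; case: (size f) => [|n] //=; rewrite ltnS mulnC; lia.
pose h := \poly_(i < g.+1) f`_i.
have sh : size h = g.+1 by rewrite size_poly_eq.
have fE : f = 2 *: 'X^(g.+1) + h.
  apply/polyP => i; rewrite coefD coefZ coefXn coef_poly.
  case: (ltngtP i g.+1) => [|hi|->]; rewrite ?mulr0 ?add0r ?mulr1 ?addr0 //.
  by rewrite nth_default ?sf.
have -> : - 'X^(2 * g + 2) + 4^-1 *: f ^+ 2 = 'X^(g.+1) * h + 4^-1 *: h ^+ 2.
  have hc : (4^-1)%:P * 4 = 1 :> {poly rat}.
    by rewrite -(rmorph_nat (@polyC rat)) -rmorphM /= mulVf.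
  have -> : (2 * g + 2 = g.+1 * 2)%N by lia.
  rewrite fE -!mul_polyC exprM (rmorph_nat (@polyC rat)).
  set c := _%:P in hc *; set Y := 'X^_.
  have -> : - Y ^+ 2 + c * (2 * Y + h) ^+ 2 =
      (c * 4 - 1) * (Y ^+ 2 + Y * h) + (Y * h + c * h ^+ 2) by ring.
  by rewrite hc subrr mul0r add0r.
have h0 : h != 0 by rewrite -size_poly_eq0 sh.
have sXh : size ('X^(g.+1) * h) = (2 * g + 2)%N.
  by rewrite size_monicM ?monicXn // size_polyXn sh; lia.
rewrite size_polyDl sXh // (leq_ltn_trans (size_scale_leq _ _)) //.
by rewrite (leq_ltn_trans (size_poly_exp_leq _ _)) // sh /=; lia.
Qed.

Let size_quad (K : fieldType) (a b : K) : size ('X^2 + a%:P * 'X + b%:P) = 3%N.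
Proof.
rewrite -addrA size_polyDl size_polyXn // size_MXaddC; case: ifP => // _.
by rewrite ltnS size_polyC; case: (_ == _).
Qed.

Let monic_quad (K : fieldType) (a b : K) : 'X^2 + a%:P * 'X + b%:P \is monic.
Proof.
by rewrite monicE lead_coefE size_quad !coefE /= mulr0 !addr0.
Qed.

Let root_quad (K : fieldType) (a b r : K) : root ('X^2 + a%:P * 'X + b%:P) r ->
  (2 * r + a) ^+ 2 = a ^+ 2 - 4 * b.
Proof.
rewrite /root !hornerE => /eqP h.
have -> : b = - (r ^+ 2 + a * r) by apply/eqP; rewrite -addr_eq0 addrC h.
by ring.
Qed.

Let tofrac_repr (r : {fraction {poly rat}}) :
  exists2 q : {poly rat}, q != 0 & exists p, r * tofrac q = tofrac p.
Proof.
elim/quotW: r => -[[p q] /= q0]; exists q => //; exists p.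
unlock FracField.tofrac; rewrite -[LHS]FracField.pi_mul; apply/eqmodP.
by rewrite /= FracField.equivfE /FracField.mulf /= !numden_Ratio ?mulf_neq0 ?oner_neq0 //= !mulr1 mulrC.
Qed.

Lemma curve_irreducible : curve_shape -> monic_irreducible_poly curve_poly.
Proof.
move=> C; split; last exact: monic_quad.
apply: cubic_irreducible; rewrite ?size_quad // => r.
apply/negP => /root_quad.
have [q q0 [p rp]] := tofrac_repr r.
move/(congr1 (fun z => z * tofrac q ^+ 2)); rewrite -exprMn mulrDl -mulrA rp.
have -> : (2 : {fraction {poly rat}}) = tofrac 2 by rewrite rmorph_nat.
have -> : (4 : {fraction {poly rat}}) = tofrac 4 by rewrite rmorph_nat.
rewrite -!(rmorphM, rmorphD, rmorphXn, rmorphN) /=.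
move/eqP; rewrite tofrac_eq => /eqP.
have -> : f ^+ 2 - 4 * 'X^d = (4 : rat) *: t_poly.
  rewrite /t_poly scalerDr scalerA mulfV // scale1r scalerN addrC.
  by rewrite scaler_nat mulr_natl.
move/(congr1 (fun z : {poly rat} => (size z).-1)).
have s4t : size (4 *: t_poly) = (2 * g + 2)%N by rewrite size_scale ?size_t_poly.
have t0 : 4 *: t_poly != 0 by rewrite -size_poly_eq0 s4t addn2.
have q20 : q ^+ 2 != 0 by rewrite expf_neq0.
have sq : size (q ^+ 2) = ((size q).-1 * 2).+1.
  by rewrite -size_exp prednK // size_poly_gt0.
by rewrite size_exp size_mul // s4t sq; lia.
Qed.

Definition function_field (C : curve_shape) :=
  {poly %/ curve_poly with curve_irreducible C}.

Variable C : curve_shape.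
HB.instance Definition _ := GRing.Field.on (function_field C).

Definition fun_of_poly (p : {poly rat}) : function_field C :=
  qpolyC curve_poly (tofrac p).
Definition coord_x : function_field C := fun_of_poly 'X.
Definition coord_y : function_field C := in_qpoly curve_poly 'X.

Lemma curve_equation :
  coord_y ^+ 2 + fun_of_poly f * coord_y + coord_x ^+ d = 0.
Proof.
have inC a : qpolyC curve_poly a = in_qpoly curve_poly a%:P.
  apply/val_inj/esym/in_qpoly_small.
  by rewrite (leq_ltn_trans (size_polyC_leq1 _)) // size_mk_monic_gt1.
rewrite /coord_x /coord_y /fun_of_poly.
have -> : qpolyC curve_poly (tofrac 'X) ^+ d = in_qpoly curve_poly (tofrac 'X^d)%:P.
  by rewrite -inC tofracXn (rmorphXn (qpolyC curve_poly)).
rewrite inC -in_qpolyM -(rmorphXn (in_qpoly curve_poly)) -!in_qpolyD.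
apply/val_inj; rewrite /= (mk_monicE (curve_irreducible C)).
by rewrite Pdiv.RingMonic.rmodpp // monic_quad.
Qed.

End Curve.

(* m lists the irreducible factors of p, each up to a nonzero constant, and
   without repetition. *)
Definition irreducible_factors (p : {poly rat}) k (m : 'I_k -> {poly rat}) :=
  [/\ forall j, irreducible_poly (m j),
      forall j, m j %| p,
      forall i j, m i %= m j -> i = j &
      forall q, irreducible_poly q -> q %| p -> exists j, q %= m j].

(* Main.v *)
Require Import Defs.
From HB Require Import structures.
From mathcomp Require Import all_boot all_order all_algebra all_field.
From mathcomp Require Import generic_quotient ring_quotient boolp.
From mathcomp Require Import zify ring.
From mathcomp.multinomials Require Import freeg.

(** Let y' = -y - f(x) be the image of y under the hyperelliptic involution, so
    that y y' = x^d, (y - y')^2 = 4 t(x) and u := y^2/x^d = y/y'.  The element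
    u is 1 at the zeros of t(x) and (-1)^d at the poles of x, which have even
    order; together with m_j(x)/m_j(0) = 1 at the zeros of x, this makes all
    the tame symbols trivial.  As t is squarefree, the product of the
    m_j(x)/m_j(0) is t(x)/t(0), which is (y - y')^2 when f(0) = 1 or -1; since
    y - y' = y (1 - y'/y), the Steinberg relation gives, up to 2-torsion,
    {y/y', (y - y')^2} = 2 {y/y', y} = 2 {y, y'} = 2 d {y, x}.
    If d = 2g+2, put w = y/x^(g+1): then u = w^2 and the quotient of
    f - 2 x^(g+1) by f + 2 x^(g+1) is ((1 + w)/(1 - w))^2, and
    {w^2, ((1 + w)/(1 - w))^2} = 0 because {w, 1 - w} = {-w, 1 + w} = 0. *)

Set Implicit Arguments.
Unset Strict Implicit.
Unset Printing Implicit Defensive.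

Import Order.TTheory GRing.Theory Num.Theory.
Local Open Scope ring_scope.

(** * Orders and values at a point *)

Section PointTheory.
Variables (F : fieldType) (P : point F).

Lemma ord_one : ord P 1 = 0.
Proof. by apply: (addrI (ord P 1)); rewrite addr0 -ordM ?oner_neq0 ?mulr1. Qed.

Lemma ordV (a : F) : a != 0 -> ord P a^-1 = - ord P a.
Proof.
by move=> a0; apply/eqP; rewrite -addr_eq0 -ordM ?invr_eq0 // mulVf // ord_one.
Qed.

Lemma ordX (a : F) (n : nat) : a != 0 -> ord P (a ^+ n) = ord P a *+ n.
Proof.
move=> a0; elim: n => [|n IH]; first by rewrite expr0 ord_one mulr0n.
by rewrite exprS ordM ?expf_neq0 // IH mulrS.
Qed.

Lemma ordN (a : F) : ord P (- a) = ord P a.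
Proof.
have [->|a0] := eqVneq a 0; first by rewrite oppr0.
have := congr1 (ord P) (sqrrN a); rewrite !ordX ?oppr_eq0 //.
by move/eqP; rewrite eqrMn2r // => /eqP.
Qed.

(* [regular] includes [0], whose order is junk. *)
Lemma regularD (a b : F) : regular P a -> regular P b -> regular P (a + b).
Proof.
rewrite /regular; have [->|a0] := eqVneq a 0; first by rewrite add0r.
have [->|b0] := eqVneq b 0; first by rewrite addr0 (negPf a0).
have [//|ab0] /= := eqVneq (a + b) 0 => ha hb.
by rewrite (le_trans _ (ordD P a0 b0 ab0)) // le_min ha.
Qed.

Lemma regularM (a b : F) : regular P a -> regular P b -> regular P (a * b).
Proof.
rewrite /regular; have [->|a0] := eqVneq a 0; first by rewrite mul0r eqxx.
have [->|b0] := eqVneq b 0; first by rewrite mulr0 eqxx.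
by rewrite /= => ha hb; rewrite ordM // addr_ge0 ?orbT.
Qed.

Lemma regularN (a : F) : regular P (- a) = regular P a.
Proof. by rewrite /regular oppr_eq0 ordN. Qed.

Lemma regular1 : regular P 1.
Proof. by rewrite /regular ord_one orbT. Qed.

Lemma regular_ord0 (a : F) : ord P a = 0 -> regular P a.
Proof. by rewrite /regular => ->; rewrite orbT. Qed.

Lemma regularX (a : F) n : regular P a -> regular P (a ^+ n).
Proof.
move=> ra; elim: n => [|n IH]; first by rewrite expr0 regular1.
by rewrite exprS regularM.
Qed.

Lemma eval0 : eval P 0 = 0.
Proof. by apply: (addrI (eval P 0)); rewrite -evalD /regular ?eqxx // !addr0. Qed.

Lemma evalN (a : F) : regular P a -> eval P (- a) = - eval P a.
Proof.
move=> ra; apply/eqP; rewrite -addr_eq0 -evalD ?addNr ?eval0 ?regularN //.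
Qed.

Lemma evalX (a : F) n : regular P a -> eval P (a ^+ n) = eval P a ^+ n.
Proof.
move=> ra; elim: n => [|n IH]; first by rewrite !expr0 eval1.
by rewrite !exprS evalM ?IH // regularX.
Qed.

Lemma eval_sign n : eval P ((-1) ^+ n) = (-1) ^+ n.
Proof. by rewrite evalX ?regularN ?regular1 // evalN ?regular1 // eval1. Qed.

Lemma eval_neq0 (a : F) : a != 0 -> ord P a = 0 -> eval P a != 0.
Proof. by move=> a0 ha; rewrite eval_eq0 ?ha ?lexx ?ltxx. Qed.

Lemma eval_pos (a : F) : 0 < ord P a -> eval P a = 0.
Proof.
have [-> _|a0 ha] := eqVneq a 0; first exact: eval0.
by apply/eqP; rewrite eval_eq0 ?(ltW ha).
Qed.

Lemma ord_eval_neq0 (a : F) : regular P a -> eval P a != 0 -> ord P a = 0.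
Proof.
rewrite /regular; have [->|a0] := eqVneq a 0; first by rewrite eval0 eqxx.
by move=> /= ra; rewrite eval_eq0 // -leNgt => ha; apply/le_anti; rewrite ha.
Qed.

Lemma evalXz (a : F) (n : int) : ord P a = 0 -> a != 0 -> eval P (a ^ n) = eval P a ^ n.
Proof.
move=> ha a0; have ra := regular_ord0 ha.
case: n => n; first by rewrite -!exprnP evalX.
rewrite NegzE -!invr_expz -!exprnP -evalX //.
have an0 : a ^+ n.+1 != 0 by rewrite expf_neq0.
have oan : ord P (a ^+ n.+1) = 0 by rewrite ordX // ha mul0rn.
have e0 := eval_neq0 an0 oan.
by apply: (mulfI e0); rewrite -evalM ?mulfV ?eval1 // regular_ord0 ?ordV ?oan ?oppr0.
Qed.

(** The reverse bound is [ordD] applied to [(a + b) - b]: the regular [b] cannot account for the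
    pole of [a]. *)
Lemma ord_addr (a b : F) : a != 0 -> regular P b -> ord P a < 0 ->
  ord P (a + b) = ord P a.
Proof.
move=> a0 rb ha; have [->|b0] := eqVneq b 0; first by rewrite addr0.
have hb : 0 <= ord P b by move: rb; rewrite /regular (negPf b0).
have ab0 : a + b != 0.
  by apply: contraTneq hb => /(canRL (addKr a)); rewrite addr0 => ->; rewrite ordN -ltNge.
apply/le_anti/andP; split.
  have := ordD P ab0 (_ : - b != 0); rewrite oppr_eq0 addrK ordN => /(_ b0 a0).
  by rewrite ge_min => /orP[//|]; rewrite leNgt (lt_le_trans ha hb).
by rewrite (le_trans _ (ordD P a0 b0 ab0)) // le_min lexx (le_trans (ltW ha) hb).
Qed.

(* Both factors are integral over the local ring, being the roots of
   [T^2 - (a + b) T + a b]. *)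
Lemma ord0_sum_prod (a b : F) : a != 0 -> b != 0 -> ord P (a * b) = 0 ->
  regular P (a + b) -> ord P a = 0.
Proof.
move=> a0 b0; rewrite ordM // => /eqP; rewrite addr_eq0 => /eqP ab rab.
(* If [c] had a pole, [e] would have a zero, so [c + e] would keep the pole. *)
have key (c e : F) : c != 0 -> ord P e = - ord P c -> regular P (c + e) ->
    ~~ (ord P c < 0).
  move=> c0 oe; apply: contraL => oc.
  rewrite /regular negb_or.
  have re : regular P e by rewrite /regular oe oppr_ge0 (ltW oc) orbT.
  have oce := ord_addr c0 re oc.
  rewrite -ltNge oce oc andbT; apply: contraTneq oc => ce0.
  by move: oe; rewrite -(addKr c e) ce0 addr0 ordN => oc; lia.
have ba : ord P b = - ord P a by rewrite ab opprK.
have := key a b a0 ba rab; have := key b a b0 ab; rewrite addrC => /(_ rab).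
by clear - ab; lia.
Qed.

Lemma tame_formula_ord0l (a b : F) : a != 0 -> ord P a = 0 ->
  tame_formula P a b = eval P a ^ ord P b.
Proof.
by move=> a0 oa; rewrite /tame_formula oa mul0r !expr0z mul1r divr1 evalXz.
Qed.

Lemma tame_formula_eval1r (a b : F) : b != 0 -> ord P b = 0 -> eval P b = 1 ->
  tame_formula P a b = 1.
Proof.
move=> b0 ob eb; rewrite /tame_formula ob mulr0 !expr0z !mul1r.
by rewrite invr_expz evalXz // eb exp1rz.
Qed.

(** When the orders are multiples [k c] and [l c], the symbol is, up to sign, a power of the value
    of the single unit [a ^+ l / b ^+ k]; the sign depends only on the parities of [k], [l] and
    [c]. *)
Lemma tame_formula_multiple (a b : F) (k l : nat) (c : int) : a != 0 -> b != 0 ->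
  ord P a = k%:Z * c -> ord P b = l%:Z * c ->
  tame_formula P a b = ((-1) ^+ (k * l * `|c|) * eval P (a ^+ l / b ^+ k)) ^ c.
Proof.
move=> a0 b0 oa ob; have q0 : a ^+ l / b ^+ k != 0.
  by rewrite mulf_neq0 ?invr_eq0 ?expf_neq0.
rewrite expfzMl /tame_formula oa ob; congr (_ * _).
  have sgz (n : int) : (-1 : algC) ^ n = (-1) ^+ odd `|n|.
    case: n => n; first by rewrite -exprnP signr_odd.
    by rewrite NegzE abszN -invr_expz -exprnP -[in LHS]signr_odd invr_sign.
  rewrite exprnP exprz_exp !sgz !abszM /=.
  by rewrite !oddM; case: (odd k); case: (odd l); case: (odd `|c|%N).
rewrite -evalXz //; last first.
  by rewrite ordM ?invr_eq0 ?expf_neq0 // ordV ?expf_neq0 // !ordX // oa ob; lia.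
by rewrite expfzMl !exprnP !exprz_exp exprz_inv -invr_expz exprz_exp.
Qed.

End PointTheory.

(** * Values and orders of polynomials in x at a point *)

Section PolynomialsAtPoints.
Variables (F : fieldType) (phi : {rmorphism {poly rat} -> F}) (P : point F).

Lemma regular_int (n : int) : regular P n%:~R.
Proof.
have regn (k : nat) : regular P k%:R.
  by elim: k => [|k IH]; rewrite ?mulrS ?regularD ?regular1 // /regular eqxx.
by case: n => n; rewrite ?NegzE ?mulrNz ?regularN regn.
Qed.

Lemma eval_int (n : int) : eval P n%:~R = n%:~R.
Proof.
have evn (k : nat) : eval P k%:R = k%:R.
  elim: k => [|k IH]; first by rewrite eval0.
  by rewrite !mulrS evalD ?eval1 ?IH ?regular1 // (regular_int k).
by case: n => n; rewrite ?NegzE ?mulrNz ?evalN ?evn // (regular_int n.+1).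
Qed.

(** Write [c] as numerator over denominator: nonzero integers have nonzero values in characteristic
    0, so they are units at [P]. *)
Lemma eval_const (c : rat) :
  regular P (phi c%:P) /\ eval P (phi c%:P) = ratr c.
Proof.
have eE : eval P (denq c)%:~R != 0 by rewrite eval_int intr_eq0 denq_neq0.
have D0 : (denq c)%:~R != 0 :> F by apply: contraNneq eE => ->; rewrite eval0.
have oD := ord_eval_neq0 (regular_int _) eE.
have cD : phi c%:P * (denq c)%:~R = (numq c)%:~R.
  have cq : c * (denq c)%:~R = (numq c)%:~R.
    by rewrite -[X in X * _]divq_num_den divfK // intr_eq0 denq_neq0.
  by rewrite -!(rmorph_int (phi \o polyC)) -cq [RHS]rmorphM.
have rc : regular P (phi c%:P).
  have := regular_int (numq c); rewrite -cD /regular mulf_eq0 (negPf D0) orbF.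
  by have [//|c0] := eqVneq (phi c%:P) 0; rewrite /= ordM // oD addr0.
split=> //; apply: (mulIf eE).
by rewrite -evalM ?regular_int // cD !eval_int /ratr divfK // intr_eq0 denq_neq0.
Qed.

Lemma ord_const (c : rat) : c != 0 -> ord P (phi c%:P) = 0.
Proof.
by case: (eval_const c) => rc ec c0; rewrite ord_eval_neq0 // ec fmorph_eq0.
Qed.

Lemma eval_poly (p : {poly rat}) : regular P (phi 'X) ->
  regular P (phi p) /\ eval P (phi p) = (map_poly ratr p).[eval P (phi 'X)].
Proof.
move=> rx; elim/poly_ind: p => [|p c [rp ep]].
  by rewrite !rmorph0 horner0 eval0 /regular eqxx.
have [rc ec] := eval_const c; have rpx := regularM rp rx.
rewrite !rmorphD !rmorphM /= map_polyX map_polyC !hornerE /=.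
by rewrite evalD // evalM // ep ec regularD.
Qed.

(** The leading term dominates: in the Horner form [p * 'X + c] with [p] nonzero, the first summand
    has a pole and the second is regular. *)
Lemma ord_poly_pole (p : {poly rat}) : injective phi -> ord P (phi 'X) < 0 ->
  p != 0 -> ord P (phi p) = ord P (phi 'X) *+ (size p).-1.
Proof.
move=> phi_inj ox; have x0 : phi 'X != 0 by rewrite raddf_eq0 ?polyX_eq0.
elim/poly_ind: p => [|p c IH]; first by rewrite eqxx.
have [->|p0 pc0] := eqVneq p 0.
  rewrite mul0r add0r polyC_eq0 => c0.
  by rewrite ord_const // size_polyC c0 mulr0n.
have sp : (0 < size p)%N by rewrite size_poly_gt0.
have phip0 : phi p != 0 by rewrite raddf_eq0.
have opX : ord P (phi p * phi 'X) = ord P (phi 'X) *+ size p.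
  by rewrite ordM // IH // -mulrSr prednK.
rewrite rmorphD rmorphM /= ord_addr ?mulf_neq0 ?opX //.
- by rewrite size_MXaddC (negPf p0).
- by case: (eval_const c).
- by rewrite mulrn_wlt0 // -lt0n.
Qed.

End PolynomialsAtPoints.

(** * Symbols *)

Section SymbolTheory.
Variable F : fieldType.
Implicit Types a b c w : F.

Let pi_eq0 (D : {freeg (nzelt F * nzelt F)}) : K2_rel D ->
  \pi_({ideal_quot (@K2_rels F)})%qT D = 0.
Proof.
move=> rD; rewrite -(raddf0 (\pi_({ideal_quot (@K2_rels F)})%qT)).
by apply/eqP; rewrite -Quotient.idealrBE subr0; apply/asboolP.
Qed.

Lemma symbolMl a b c : a != 0 -> b != 0 ->
  symbol (a * b) c = symbol a c + symbol b c.
Proof.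
move=> a0 b0; apply/eqP; rewrite -subr_eq0 opprD addrA -!raddfB /=.
by have := K2_rel_mull (nz a) (nz b) (nz c); rewrite !nzK // => /pi_eq0 ->.
Qed.

Lemma symbolMr a b c : b != 0 -> c != 0 ->
  symbol a (b * c) = symbol a b + symbol a c.
Proof.
move=> b0 c0; apply/eqP; rewrite -subr_eq0 opprD addrA -!raddfB /=.
by have := K2_rel_mulr (nz a) (nz b) (nz c); rewrite !nzK // => /pi_eq0 ->.
Qed.

Lemma symbol_steinberg a : a != 0 -> a != 1 -> symbol a (1 - a) = 0.
Proof. by move=> a0 a1; apply/pi_eq0/K2_rel_steinberg. Qed.

Lemma symbol1l a : symbol 1 a = 0.
Proof. by apply: (addrI (symbol 1 a)); rewrite addr0 -symbolMl ?oner_neq0 ?mulr1. Qed.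

Lemma symbol1r a : symbol a 1 = 0.
Proof. by apply: (addrI (symbol a 1)); rewrite addr0 -symbolMr ?oner_neq0 ?mulr1. Qed.

Lemma symbolVl a b : a != 0 -> symbol a^-1 b = - symbol a b.
Proof.
by move=> a0; apply/eqP; rewrite -addr_eq0 -symbolMl ?invr_eq0 // mulVf ?symbol1l.
Qed.

Lemma symbolVr a b : b != 0 -> symbol a b^-1 = - symbol a b.
Proof.
by move=> b0; apply/eqP; rewrite -addr_eq0 -symbolMr ?invr_eq0 // mulVf ?symbol1r.
Qed.

Lemma symbolXl a b n : a != 0 -> symbol (a ^+ n) b = symbol a b *+ n.
Proof.
move=> a0; elim: n => [|n IH]; first by rewrite expr0 symbol1l.
by rewrite exprS symbolMl ?expf_neq0 // IH mulrS.
Qed.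

Lemma symbolXr a b n : b != 0 -> symbol a (b ^+ n) = symbol a b *+ n.
Proof.
move=> b0; elim: n => [|n IH]; first by rewrite expr0 symbol1r.
by rewrite exprS symbolMr ?expf_neq0 // IH mulrS.
Qed.

Lemma symbol_prodr (I : Type) (r : seq I) (Q : pred I) (h : I -> F) a :
  (forall i, h i != 0) ->
  symbol a (\prod_(i <- r | Q i) h i) = \sum_(i <- r | Q i) symbol a (h i).
Proof.
move=> h0; elim: r => [|i r IH]; first by rewrite !big_nil symbol1r.
rewrite !big_cons; case: ifP => // _; rewrite symbolMr ?IH //.
by apply: (big_ind (fun z => z != 0)) => // [|u v]; [exact: oner_neq0 | exact: mulf_neq0].
Qed.

(* [- a = (1 - a) / (1 - a^-1)] *)
Lemma symbolN a : a != 0 -> symbol a (- a) = 0.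
Proof.
move=> a0; have [->|a1] := eqVneq a 1; first by rewrite symbol1l.
have b0 : 1 - a != 0 by rewrite subr_eq0 eq_sym.
have av1 : a^-1 != 1 by rewrite invr_eq1.
have c0 : 1 - a^-1 != 0 by rewrite subr_eq0 eq_sym.
have -> : - a = (1 - a) / (1 - a^-1).
  by apply: (mulIf c0); rewrite divfK // mulrBr mulr1 mulNr mulfV // opprK addrC.
rewrite symbolMr ?invr_eq0 // symbolVr // symbol_steinberg // add0r.
by rewrite -symbolVl // symbol_steinberg ?invr_eq0.
Qed.

(** Expand [{ab, -ab} = 0] and use [{a, -a} = {b, -b} = 0]. *)
Lemma symbolC a b : a != 0 -> b != 0 -> symbol b a = - symbol a b.
Proof.
move=> a0 b0; apply/eqP; rewrite -addr_eq0 addrC; apply/eqP.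
have := symbolN (mulf_neq0 a0 b0); rewrite symbolMl // => <-; congr (_ + _).
  by rewrite -mulNr symbolMr ?oppr_eq0 // symbolN // add0r.
by rewrite -mulrN symbolMr ?oppr_eq0 // symbolN // addr0.
Qed.

Lemma symbolNr a b : b != 0 -> symbol a (- b) *+ 2 = symbol a b *+ 2.
Proof. by move=> b0; rewrite -!symbolXr ?oppr_eq0 // sqrrN. Qed.

Lemma symbolNl a b : a != 0 -> symbol (- a) b *+ 2 = symbol a b *+ 2.
Proof. by move=> a0; rewrite -!symbolXl ?oppr_eq0 // sqrrN. Qed.

Lemma symbol_diag a : a != 0 -> symbol a a *+ 2 = 0.
Proof. by move=> a0; rewrite -symbolNr // symbolN // mul0rn. Qed.

(** As [a - b = a (1 - b / a)] and the Steinberg relation kills [{a / b, 1 - b / a}], what is left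
    is [2 {a / b, a}]. Since [2 {a, a} = 0], this is [-2 {b, a} = 2 {a, b} = 2 {a, a b}]. *)
Lemma symbol_conj_sub a b x n : a != 0 -> b != 0 -> x != 0 -> a != b ->
  a * b = x ^+ n ->
  symbol (a / b) ((a - b) ^+ 2) = symbol a x *+ n *+ 2.
Proof.
move=> a0 b0 x0 ab abx; have q0 : a / b != 0 by rewrite mulf_neq0 ?invr_eq0.
have q'0 : b / a != 0 by rewrite mulf_neq0 ?invr_eq0.
have q'1 : b / a != 1 by apply: contra_neq ab => /divr1_eq ->.
have q1 : 1 - b / a != 0 by rewrite subr_eq0 eq_sym.
have -> : a - b = a * (1 - b / a) by rewrite mulrBr mulr1 mulrCA mulfV // mulr1.
rewrite symbolXr ?mulf_neq0 // symbolMr //.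
have -> : symbol (a / b) (1 - b / a) = 0.
  by rewrite -[a / b]invf_div symbolVl // symbol_steinberg // oppr0.
rewrite addr0 -(symbolXr a n x0) -abx symbolMr // [RHS]mulrnDl symbol_diag // add0r.
rewrite symbolMl ?invr_eq0 // symbolVl // mulrnDl symbol_diag // add0r.
by rewrite (symbolC a0 b0) opprK.
Qed.

Lemma symbol_cayley w : w != 0 -> w != 1 -> w != -1 ->
  symbol (w ^+ 2) (((1 + w) / (1 - w)) ^+ 2) = 0.
Proof.
move=> w0 w1 wN1; have p0 : 1 + w != 0 by rewrite addrC addr_eq0.
have n0 : 1 - w != 0 by rewrite subr_eq0 eq_sym.
rewrite symbolXr ?mulf_neq0 ?invr_eq0 // symbolXl //.
rewrite symbolMr ?invr_eq0 // symbolVr // symbol_steinberg // oppr0 addr0.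
(* The factor 2 from the square in the left entry allows [- w] to replace [w]. *)
rewrite -symbolNl // -[w in 1 + w]opprK symbol_steinberg ?mul0rn ?oppr_eq0 //.
by rewrite -[1]opprK eqr_opp.
Qed.

End SymbolTheory.

(** * Classes modulo torsion and the tame kernel *)

Lemma class_mod_torsion_is_zmod_morphism (A : zmodType) :
  zmod_morphism (@class_mod_torsion A).
Proof. by move=> a b; rewrite /class_mod_torsion raddfB. Qed.
HB.instance Definition _ (A : zmodType) := GRing.isZmodMorphism.Build
  A (mod_torsion A) (@class_mod_torsion A) (@class_mod_torsion_is_zmod_morphism A).

Lemma class_mod_torsion_eq (A : zmodType) (a b : A) n : (0 < n)%N ->
  a *+ n = b *+ n -> class_mod_torsion a = class_mod_torsion b.
Proof.
move=> n0 ab; apply/eqP; rewrite /class_mod_torsion -Quotient.idealrBE.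
by apply/asboolP; exists n => //; rewrite mulrnBl ab subrr.
Qed.

Lemma K2Tval_is_zmod_morphism (F : fieldType) : zmod_morphism (@K2Tval F).
Proof. by move=> a b; have := raddfB (val : K2T F -> K2 F) a b. Qed.
HB.instance Definition _ (F : fieldType) := GRing.isZmodMorphism.Build
  (K2T F) (K2 F) (@K2Tval F) (@K2Tval_is_zmod_morphism F).

Lemma symbol_in_tame_kernel (F : fieldType) (a b : F) : a != 0 -> b != 0 ->
  (forall P : point F, tame_formula P a b = 1) -> symbol a b \in @tame_kernel F.
Proof. by move=> a0 b0 h; apply/asboolP => P; rewrite tame_symbol. Qed.

(** * Squarefree polynomials *)

(** Descent on the size: a reducible [q] has a nonconstant divisor of strictly smaller size. *)
Lemma exists_irreducible_factor (q : {poly rat}) : (1 < size q)%N ->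
  exists2 r, irreducible_poly r & r %| q.
Proof.
have [n] := ubnP (size q); elim: n q => // n IH q; rewrite ltnS => sq q1.
have [irr|/not_andP[//|]] := pselect (irreducible_poly q).
  by exists q.
move=> /existsNP[r /not_implyP[r1 /not_implyP[rq]]] /negP nrq.
have q0 : q != 0 by rewrite -size_poly_gt0 (ltn_trans _ q1).
have r0 : r != 0 by apply: contraTneq rq => ->; rewrite dvd0p.
have sr : (size r < size q)%N.
  by rewrite ltn_neqAle dvdp_leq // andbT dvdp_size_eqp.
have [||s irr sr'] := IH r.
- exact: leq_trans sr sq.
- by rewrite ltn_neqAle eq_sym r1 size_poly_gt0.
by exists s => //; apply: dvdp_trans rq.
Qed.

(** A root of [p] in [algC] would be at least a double root of [t]. *)
Lemma simple_roots_squarefree (t p : {poly rat}) : t != 0 ->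
  (forall z : algC, (mup z (map_poly ratr t) <= 1)%N) -> (1 < size p)%N ->
  ~~ (p ^+ 2 %| t).
Proof.
move=> t0 t_simple p1; apply/negP => pt.
have /closed_rootP[z] : size (map_poly (ratr : rat -> algC) p) != 1.
  by rewrite size_map_poly gtn_eqF.
rewrite -dvdp_XsubCl => zp.
have := t_simple z; rewrite leqNgt mup_geq ?map_poly_eq0 // => /negP[].
apply: dvdp_trans (_ : map_poly ratr (p ^+ 2) %| _); last by rewrite dvdp_map.
by rewrite rmorphXn !expr2 dvdp_mul.
Qed.

(** The [m j] are pairwise coprime, so their product divides [t]. A nonconstant cofactor would
    contain some [m j] once more, and its square would divide [t]. *)
Lemma prod_irreducible_factors (t : {poly rat}) k (m : 'I_k -> {poly rat}) :
  t != 0 -> (forall p : {poly rat}, (1 < size p)%N -> ~~ (p ^+ 2 %| t)) ->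
  irreducible_factors t m -> \prod_(j < k) m j %= t.
Proof.
move=> t0 t_sqf [m_irr m_dvd m_inj m_all].
have [q tE] : exists q, t = q * \prod_(j < k) m j.
  apply/dvdpP; have := enum_uniq 'I_k; rewrite -big_enum /=.
  elim: (enum _) => [|i s IH] /=; first by rewrite big_nil dvd1p.
  case/andP=> is_ us; rewrite big_cons Gauss_dvdp ?m_dvd ?IH //.
  rewrite big_seq; apply: (big_ind (coprimep (m i))) => [|a b|j js].
  - exact: coprimep1.
  - by rewrite coprimepMr => -> ->.
  rewrite irreducible_poly_coprime //; apply: contraNN is_ => mij.
  suff -> : i = j by [].
  by apply: m_inj; apply: (m_irr j).2 => //; rewrite gtn_eqF // (m_irr i).1.
have q0 : q != 0 by apply: contraNneq t0 => q0; rewrite tE q0 mul0r.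
have [q1|] := ltnP 1 (size q); last first.
  rewrite leq_eqVlt ltnS leqn0 size_poly_eq0 (negPf q0) orbF => q1.
  by rewrite tE eqp_sym -{2}[\prod_j _]mul1r eqp_mulr // -size_poly_eq1.
have [r irr rq] := exists_irreducible_factor q1.
have [|j rj] := m_all r irr; first by rewrite tE dvdp_mulr.
have /negP[] := t_sqf (m j) (m_irr j).1.
rewrite expr2 tE dvdp_mul //; first by rewrite -(eqp_dvdl _ rj).
by rewrite (bigD1 j) //= dvdp_mulr.
Qed.

(** * The curve *)

Section CurveFunctions.
Variables (g d : nat) (f : {poly rat}).
Hypothesis C : curve_shape g d f.
(** The function field enters only through an embedding [phi] of the polynomials in x and a solution
    [y] of the curve equation; this keeps its construction as a quotient out of the computations. *)
Variables (F : fieldType) (phi : {rmorphism {poly rat} -> F}) (y : F).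
Hypothesis phi_inj : injective phi.
Hypothesis y_eq : y ^+ 2 + phi f * y + phi 'X ^+ d = 0.

Let x := phi 'X.
Let y' := - (y + phi f).

Let x0 : x != 0. Proof. by rewrite raddf_eq0 ?polyX_eq0. Qed.

Let d_gt0 : (0 < d)%N.
Proof. by case: C => [[->]|[->]] *; rewrite ?addn1 ?addn2. Qed.

Lemma conj_prod : y * y' = x ^+ d.
Proof. by apply/eqP; rewrite /y' mulrN eq_sym -addr_eq0 addrC -y_eq /x; apply/eqP; ring. Qed.

Lemma conj_sum : y + y' = - phi f. Proof. by rewrite /y'; ring. Qed.

Lemma y_neq0 : y != 0.
Proof.
have : y * y' != 0 by rewrite conj_prod expf_neq0.
by rewrite mulf_eq0 negb_or => /andP[].
Qed.

Lemma conj_neq0 : y' != 0.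
Proof.
have : y * y' != 0 by rewrite conj_prod expf_neq0.
by rewrite mulf_eq0 negb_or => /andP[].
Qed.

Lemma conj_quotient : y ^+ 2 / x ^+ d = y / y'.
Proof. by rewrite -conj_prod invfM mulrA expr2 mulfK ?y_neq0. Qed.

Lemma conj_sub_sqr : (y - y') ^+ 2 = phi (4 *: t_poly d f).
Proof.
have -> : 4 *: t_poly d f = f ^+ 2 - 4 * 'X^d.
  rewrite /t_poly scalerDr scalerA mulfV // scale1r scalerN addrC.
  by rewrite scaler_nat mulr_natl.
rewrite rmorphB rmorphXn rmorphM rmorphXn rmorph_nat /= -/x -conj_prod /y'; ring.
Qed.

Lemma conj_neq : y != y'.
Proof.
have : (y - y') ^+ 2 != 0.
  rewrite conj_sub_sqr raddf_eq0 // scaler_eq0 /=.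
  by rewrite -size_poly_eq0 (size_t_poly C) addn2.
by rewrite expf_eq0 /= subr_eq0.
Qed.

(** * Triviality of the tame symbols at each point *)

Section AtPoint.
Hypothesis f0 : f.[0] != 0.
Variable P : point F.
Let e := ord P x.

(** The tame symbols at a pole of [x] depend only on the ratio [2 : d] of the orders of [x] and [y],
    on the parity of [e], and on the value of the unit [y ^+ 2 / x ^+ d]; the exact [c] is left
    open. *)
Lemma pole_behaviour : e < 0 -> exists2 c : int, e = 2%:Z * c &
  ord P y = d%:Z * c /\ eval P (y ^+ 2 / x ^+ d) = (-1) ^+ d.
Proof.
move=> e0; have y0 := y_neq0.
have xd0 n : x ^+ n != 0 by rewrite expf_neq0.
have oyq z : z = y ^+ 2 / x ^+ d -> ord P z = 0 -> ord P y *+ 2 = e *+ d.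
  move=> -> /eqP; rewrite ordM ?invr_eq0 ?expf_neq0 // ordV // !ordX //.
  by rewrite subr_eq0 => /eqP.
(* At a pole of [x], [u = y^2 / x^d] satisfies [u + u^-1 = f^2 / x^d - 2] in
   the odd degree case; in the even degree case [u = w^2] with
   [w + w^-1 = - f / x^(g+1)], and [b_g != 0] makes the order of [x] even. *)
case: C => [[dE sf]|[dE sf lf nf]].
  set z := y ^+ 2 / x ^+ d; have z0 : z != 0 by rewrite mulf_neq0 ?invr_eq0 ?expf_neq0.
  pose r := phi f ^+ 2 / x ^+ d.
  have q0 : phi f != 0.
    by rewrite raddf_eq0 //; apply: contraNneq f0 => ->; rewrite horner0.
  (* Here [2 deg f <= 2g < d], and [x] has a pole. *)
  have r_pos : 0 < ord P r.
    rewrite ordM ?invr_eq0 ?expf_neq0 // ordV // !ordX // ord_poly_pole // -/x -/e.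
      by clear - e0 dE sf; case: (size f) sf => [|s] sf /=; nia.
    by rewrite -(raddf_eq0 _ phi_inj).
  have rr : regular P r by rewrite /regular (ltW r_pos) orbT.
  (* From [y / y' + y' / y = (y + y')^2 / (y y') - 2]. *)
  have zr : z + z^-1 = r - 2.
    rewrite /z /r conj_quotient -(sqrrN (phi f)) -conj_sum -conj_prod.
    by move: y_neq0 conj_neq0; move: y y' => a b a0 b0; field; rewrite b0.
  have r2 : regular P (2 : F) by exact: (regular_int P 2).
  have oz : ord P z = 0.
    apply: (@ord0_sum_prod _ P z z^-1); rewrite ?invr_eq0 ?mulfV ?ord_one //.
    by rewrite zr regularD ?regularN.
  have oy := oyq z erefl oz.
  (* [2 ord y = (2g + 1) e] gives [e = 2 (ord y - g e)]. *)
  have [c ec] : exists c : int, e = 2%:Z * c.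
    exists (ord P y - e * g%:Z). rewrite dE in oy. clear - oy. lia.
  exists c => //; split; first by clear - oy ec; lia.
  have rz := regular_ord0 oz.
  have r1 := regular1 P.
  (* The relation for [z + z^-1] reads [(z + 1)^2 = z r], and [r] vanishes at [P]; hence [z] has
     value -1. *)
  have : eval P ((z + 1) ^+ 2) = eval P (z * r).
    by congr (eval P _); rewrite -[r](subrK 2) -zr; field.
  rewrite evalX ?regularD // evalM // (eval_pos r_pos) mulr0 evalD // eval1.
  move/eqP; rewrite expf_eq0 /= addr_eq0 => /eqP ->.
  by rewrite dE exprD exprM sqrrN !expr1n mul1r.
(* The leading terms cancel and [b_g] is nonzero, so [h] has degree exactly [g] and [phi h / X] has
   order [- e]. *)
pose h := f - 2 *: 'X^(g.+1); pose X := x ^+ g.+1.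
have hn i : h`_i = if (i <= g)%N then f`_i else 0.
  rewrite coefB coefZ coefXn; case: (ltngtP i g.+1) => [hi|hi|->].
  - by rewrite -ltnS hi mulr0 subr0.
  - by rewrite leqNgt (ltnW hi) /= mulr0 subr0 nth_default // sf.
  - by rewrite ltnn mulr1 lf subrr.
have sh : size h = g.+1.
  apply/eqP; rewrite eqn_leq; apply/andP; split.
    by apply/leq_sizeP => i hi; rewrite hn leqNgt hi.
  by rewrite ltnNge; apply: contra nf => hs; have := hn g; rewrite leqnn nth_default // => <-.
have h0 : h != 0 by rewrite -size_poly_eq0 sh.
have ph0 : phi h != 0 by rewrite raddf_eq0.
have X0 : X != 0 by rewrite expf_neq0.
pose w := y / X; pose r := phi h / X.
have w0 : w != 0 by rewrite mulf_neq0 ?invr_eq0.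
have r0 : r != 0 by rewrite mulf_neq0 ?invr_eq0.
have or_e : ord P r = - e.
  rewrite ordM ?invr_eq0 // ordV // /X ordX // ord_poly_pole // sh -/x -/e /=.
  by clear; lia.
have rr : regular P r by rewrite /regular or_e; clear - e0; lia.
have XX : X ^+ 2 = x ^+ d by rewrite dE /X -exprM mulnC mulnS addnC.
(* Since [w^-1 = y' / X], the sum is [- phi f / X]. *)
have wr : w + w^-1 = - (r + 2).
  have -> : r + 2 = phi f / X.
    rewrite /r /h scaler_nat rmorphB rmorphMn rmorphXn /= -/x -/X.
    by rewrite mulrBl mulrnAl mulfV // subrK.
  rewrite -mulNr -conj_sum /w.
  have -> : y' = X ^+ 2 / y by rewrite XX -conj_prod mulrAC mulfV // mul1r.
  by field; rewrite y0 X0.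
have r2 : regular P (2 : F) by exact: (regular_int P 2).
have ow : ord P w = 0.
  apply: (@ord0_sum_prod _ P w w^-1); rewrite ?invr_eq0 ?mulfV ?ord_one //.
  by rewrite wr regularN regularD.
have rw := regular_ord0 ow; have r1 := regular1 P.
(* Taking orders, [2 ord (w + 1) = - e]: this makes [e] even and gives [w] the value -1. *)
have w1 : (w + 1) ^+ 2 = - (w * r).
  by rewrite -mulrN -[- r](addrK (-2)) -opprD -wr; field.
have w10 : w + 1 != 0.
  have : (w + 1) ^+ 2 != 0 by rewrite w1 oppr_eq0 mulf_neq0.
  by rewrite expf_eq0.
have ow1 : ord P (w + 1) *+ 2 = - e.
  by rewrite -ordX // w1 ordN ordM // ow add0r.
exists (- ord P (w + 1)); first by clear - ow1; lia.
have uw : y ^+ 2 / x ^+ d = w ^+ 2 by rewrite -XX expr_div_n.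
split.
  have : ord P w = 0 by []; rewrite ordM ?invr_eq0 // ordV // /X ordX // -/e dE.
  by clear - ow1; nia.
have : 0 < ord P (w + 1) by clear - ow1 e0; lia.
move/eval_pos; rewrite evalD // eval1 => /eqP; rewrite addr_eq0 => /eqP ew.
by rewrite uw evalX // ew dE exprD exprM sqrrN !expr1n mul1r.
Qed.

(** Here [y] and [y'] have a unit as product and a regular sum. *)
Lemma ord_y_eq0 : e = 0 -> ord P y = 0.
Proof.
move=> e0; apply: (@ord0_sum_prod _ P y y'); rewrite ?y_neq0 ?conj_neq0 //.
  by rewrite conj_prod ordX // -/e e0 mul0rn.
by rewrite conj_sum regularN; case: (eval_poly f (regular_ord0 e0)).
Qed.

Lemma tame_y_poly (p : {poly rat}) : p.[0] = 1 -> p %| t_poly d f ->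
  tame_formula P (y ^+ 2 / x ^+ d) (phi p) = 1.
Proof.
move=> p01 pt; have y0 := y_neq0.
have p0 : p != 0 by apply: contra_eq_neq p01 => ->; rewrite horner0 eq_sym oner_neq0.
have u0 : y ^+ 2 / x ^+ d != 0 by rewrite mulf_neq0 ?invr_eq0 ?expf_neq0.
have ou : ord P (y ^+ 2 / x ^+ d) = ord P y *+ 2 - e *+ d.
  by rewrite ordM ?invr_eq0 ?expf_neq0 // ordV ?expf_neq0 // !ordX.
case: (ltgtP e 0) => he.
- have [c ec [oy eu]] := pole_behaviour he.
  rewrite tame_formula_ord0l //; last by rewrite ou oy ec; clear; lia.
  (* The order of [phi p] is a multiple of [2 c], so the value [(-1)^d] is raised to an even
     power. *)
  rewrite ord_poly_pole // -/x -/e ec eu exprnP exprz_exp -mulrnAr mulrCA.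
  by rewrite -exprz_exp -exprnP sqrrN expr1n exp1rz.
- have rx : regular P x by rewrite /regular (ltW he) orbT.
  have [rp] := eval_poly p rx.
  (* At a zero of [x] the value of [phi p] is [p(0) = 1]. *)
  rewrite (eval_pos he) -[X in _.[X]](rmorph0 (ratr : rat -> algC)) horner_map /= p01 rmorph1 => ep.
  apply: tame_formula_eval1r => //; first by rewrite raddf_eq0.
  by rewrite ord_eval_neq0 // ep oner_neq0.
- have oy := ord_y_eq0 he.
  have ou0 : ord P (y ^+ 2 / x ^+ d) = 0 by rewrite ou oy he !mul0rn subrr.
  rewrite tame_formula_ord0l //.
  have rx := regular_ord0 he.
  have [rp _] := eval_poly p rx.
  have pp0 : phi p != 0 by rewrite raddf_eq0.
  (* Where [p] does not vanish the exponent is 0. Where it does, so does [4 t = (y - y')^2], and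
     then [y / y'] has value 1. *)
  have [->|np] := eqVneq (ord P (phi p)) 0; first by rewrite expr0z.
  have ep : eval P (phi p) = 0.
    by apply: eval_pos; move: rp; rewrite /regular (negPf pp0) lt_neqAle eq_sym np.
  have ry := regular_ord0 oy.
  have ry' : regular P y'.
    by rewrite regularN regularD //; case: (eval_poly f rx).
  have eyy : eval P y = eval P y'.
    have rNy' : regular P (- y') by rewrite regularN.
    apply/eqP; rewrite -subr_eq0 -(evalN ry') -(evalD ry rNy').
    have : eval P ((y - y') ^+ 2) == 0.
      have /dvdpP[q qE] : p %| 4 *: t_poly d f by rewrite dvdpZr.
      have [rq _] := eval_poly q rx.
      by rewrite conj_sub_sqr qE rmorphM evalM // ep mulr0.
    have ryy : regular P (y - y') by rewrite regularD // regularN.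
    by rewrite evalX // expf_eq0.
  rewrite conj_quotient.
  have oy' : ord P y' = 0.
    have := congr1 (ord P) conj_prod.
    by rewrite ordM ?conj_neq0 // ordX // oy add0r -/e he mul0rn.
  have ey'0 := eval_neq0 conj_neq0 oy'.
  have -> : eval P (y / y') = 1; last by rewrite exp1rz.
  apply: (mulIf ey'0); rewrite mul1r -{2}eyy -evalM ?divfK ?conj_neq0 //.
  by rewrite regular_ord0 // -conj_quotient.
Qed.

Lemma tame_y_x : f.[0] = 1 \/ f.[0] = -1 ->
  tame_formula P (- phi f.[0]%:P * y) (- x) = 1.
Proof.
set s := phi f.[0]%:P => fs; have y0 := y_neq0.
have s2 : s ^+ 2 = 1.
  by rewrite /s; case: fs => ->; rewrite ?rmorphN !rmorph1 ?sqrrN expr1n.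
have s0 : s != 0.
  have : s ^+ 2 != 0 by rewrite s2 oner_neq0.
  by rewrite expf_eq0.
have rs : regular P s by case: (eval_const phi P f.[0]).
have os : ord P s = 0 by apply: ord_const.
have a0 : - s * y != 0 by rewrite mulf_neq0 ?oppr_eq0.
have b0 : - x != 0 by rewrite oppr_eq0.
have oa : ord P (- s * y) = ord P y by rewrite ordM ?oppr_eq0 // ordN os add0r.
case: (ltgtP e 0) => he.
- have [c ec [oy eu]] := pole_behaviour he.
  (* The orders are [d c] and [2 c], so the unit to evaluate is [(-1)^d y^2 / x^d], whose value is
     1. *)
  rewrite (@tame_formula_multiple _ P _ _ d 2 c) ?oa ?ordN //.
  have -> : (- s * y) ^+ 2 / (- x) ^+ d = (-1) ^+ d * (y ^+ 2 / x ^+ d).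
    rewrite exprMn sqrrN s2 mul1r (exprNn x d) invfM mulrCA; congr (_ * _).
    by rewrite -exprVn invrN1.
  have rm1 : regular P (-1) by rewrite regularN regular1.
  have ou : ord P (y ^+ 2 / x ^+ d) = 0.
    rewrite ordM ?invr_eq0 ?expf_neq0 // ordV ?expf_neq0 // !ordX // -/e oy ec.
    by clear; lia.
  rewrite evalM ?eval_sign ?eu //; [|exact: regularX|exact: regular_ord0].
  by rewrite -exprD addnn -mul2n (mulnC d 2) -mulnA !(exprM _ 2) sqrrN !expr1n mulr1 exp1rz.
- have rx : regular P x by rewrite /regular (ltW he) orbT.
  have [rf] := eval_poly f rx; rewrite (eval_pos he).
  rewrite -[X in _.[X]](rmorph0 (ratr : rat -> algC)) horner_map /=.
  rewrite -(eval_const phi P f.[0]).2 -/s => ef.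
  have yyf : y * (y + phi f) = - x ^+ d.
    by rewrite -conj_prod /y' mulrN opprK.
  have yf0 : y + phi f != 0 by rewrite -oppr_eq0 conj_neq0.
  (* A pole of [y] would be a pole of [y (y + f)], which equals [- x^d]. *)
  have ry : regular P y.
    rewrite /regular (negPf y0) leNgt; apply/negP => oy.
    have oyf := ord_addr y0 rf oy.
    have := congr1 (ord P) yyf; rewrite ordN ordX // -/e ordM // oyf.
    by have := d_gt0; clear - oy he; nia.
  have ryf := regularD ry rf.
  (* At a zero of [x] the curve equation reduces to [y (y + f(0)) = 0], so [y] has value 0 or
     [- f(0)]. *)
  have : eval P y * (eval P y + eval P s) = 0.
    rewrite -ef -evalD // -evalM // yyf evalN ?regularX // evalX //.
    by rewrite (eval_pos he) expr0n gtn_eqF // oppr0.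
  have es0 := eval_neq0 s0 os.
  move/eqP; rewrite mulf_eq0 addr_eq0 => /orP[] /eqP ey.
    have ey' : eval P (y + phi f) = eval P s by rewrite evalD // ey add0r.
    have oyf : ord P (y + phi f) = 0 by rewrite ord_eval_neq0 // ey'.
    have oy : ord P y = d%:Z * e.
      have := congr1 (ord P) yyf; rewrite ordN ordX // -/e ordM // oyf addr0 => ->.
      by clear; lia.
    rewrite (@tame_formula_multiple _ P _ _ d 1 e) ?oa ?ordN ?mul1r // expr1.
    have -> : (- s * y) / (- x) ^+ d = (-1) ^+ d * (s / (y + phi f)).
      have -> : (- x) ^+ d = (-1) ^+ d * - (y * (y + phi f)) by rewrite yyf opprK (exprNn x d).
      rewrite invfM -exprVn invrN1 mulrCA; congr (_ * _).
      by rewrite invrN mulNr mulrNN invfM mulrA mulfK.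
    have rm1 : regular P (-1) by rewrite regularN regular1.
    have osf : ord P (s / (y + phi f)) = 0.
      by rewrite ordM ?invr_eq0 // ordV // os oyf subrr.
    have -> : eval P ((-1) ^+ d * (s / (y + phi f))) = (-1) ^+ d.
      rewrite evalM ?eval_sign //; [|exact: regularX|exact: regular_ord0].
      rewrite -[RHS]mulr1; congr (_ * _); apply: (mulIf es0).
      by rewrite -{1}ey' -evalM ?regular_ord0 // divfK // mul1r.
    (* The total sign is [(-1)^(d (|e| + 1) |e|)], with an even exponent. *)
    rewrite muln1 -exprD -[X in _ ^ X](gez0_abs (ltW he)) -exprnP -exprM.
    by rewrite -signr_odd !(oddM, oddD); case: (odd d); case: (odd `|e|%N).
  (* In the remaining case [- s * y] has value [s^2 = 1]. *)
  have ey0 : eval P y != 0 by rewrite ey oppr_eq0.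
  have oy := ord_eval_neq0 ry ey0.
  rewrite tame_formula_ord0l ?oa // evalM ?regularN // ey evalN // mulrNN.
  by rewrite -evalM // -expr2 s2 eval1 exp1rz.
- by rewrite tame_formula_ord0l ?oa ?ord_y_eq0 // ordN -/e he expr0z.
Qed.

End AtPoint.

(** * Relations between the symbols and between their classes *)

Lemma t_poly_neq0 : t_poly d f != 0.
Proof. by rewrite -size_poly_eq0 (size_t_poly C) addn2. Qed.

(** If [f(0) = 0], then ['X ^+ 2] divides both [f ^+ 2] and ['X^d], hence [t]. *)
Lemma f_at0_neq0 :
  (forall p : {poly rat}, (1 < size p)%N -> ~~ (p ^+ 2 %| t_poly d f)) ->
  (1 <= g)%N -> f.[0] != 0.
Proof.
move=> t_sqf g1; have := t_sqf 'X; rewrite size_polyX => /(_ isT).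
apply: contraNneq => f0; rewrite /t_poly dvdp_add ?dvdpNr //.
  by rewrite dvdp_exp2l //; case: C => [[->]|[->]] *; lia.
rewrite dvdpZr //; apply: dvdp_exp2r.
by rewrite -['X]subr0 dvdp_XsubCl; apply/eqP.
Qed.

(** The even multiplier [2 * d] absorbs the signs in both entries; then [symbol_conj_sub] applies to
    [y] and [y']. *)
Lemma symbol_y_t : f.[0] = 1 \/ f.[0] = -1 ->
  symbol (- phi f.[0]%:P * y) (- x) *+ (2 * d) *+ 2 =
  symbol (y ^+ 2 / x ^+ d) (phi (4 *: t_poly d f)) *+ 2.
Proof.
move=> fs; have y0 := y_neq0; have y'0 := conj_neq0.
rewrite conj_quotient -conj_sub_sqr.
rewrite (symbol_conj_sub y0 y'0 x0 conj_neq conj_prod).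
have -> : symbol (- phi f.[0]%:P * y) (- x) *+ (2 * d) = symbol y x *+ (2 * d).
  rewrite !mulrnA; congr (_ *+ d); rewrite symbolNr //.
  by case: fs => ->; rewrite ?rmorphN rmorph1 ?opprK ?mul1r // mulN1r symbolNl.
by rewrite mulrnA [_ *+ 2 *+ d]mulrnAC.
Qed.

Lemma symbol_y_split : d = (2 * g + 2)%N ->
  symbol (y ^+ 2 / x ^+ d) (phi (f - 2 *: 'X^(g.+1))) =
  symbol (y ^+ 2 / x ^+ d) (phi (f + 2 *: 'X^(g.+1))).
Proof.
move=> dE; have y0 := y_neq0.
pose X := x ^+ g.+1; pose w := y / X.
have X0 : X != 0 by rewrite expf_neq0.
have w0 : w != 0 by rewrite mulf_neq0 ?invr_eq0.
have XX : X ^+ 2 = x ^+ d by rewrite dE /X -exprM mulnC mulnS addnC.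
have yw : y = X * w by rewrite /w mulrC divfK.
(* As [y y' = X^2], the conjugate [y'] is [X / w]. *)
have fw : phi f = - (X * w + X / w).
  have y'w : y' = X / w.
    apply: (mulfI y0); rewrite conj_prod -/x -XX {1}yw.
    by field.
  by rewrite -yw -y'w /y' opprB addrC addKr.
(* Otherwise [y^2 = y y'], contrary to [y != y']; this excludes [w = 1] and [w = -1]. *)
have yy : y ^+ 2 != X ^+ 2.
  rewrite XX -conj_prod expr2; apply: contra_neq conj_neq.
  exact: mulfI.
have w1 : w != 1 by apply: contra_neq yy => wE; rewrite yw wE mulr1.
have wN1 : w != -1 by apply: contra_neq yy => wE; rewrite yw wE mulrN1 sqrrN.
have nw0 : 1 - w != 0 by rewrite subr_eq0 eq_sym.
have pw0 : 1 + w != 0 by rewrite addrC addr_eq0.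
have phi2X : phi (2 *: 'X^(g.+1)) = 2 * X.
  by rewrite scaler_nat rmorphMn rmorphXn mulr_natl.
(* Both factors of [4 t] are squares up to the common factor [- X / w]. *)
have fp : phi (f + 2 *: 'X^(g.+1)) = - (X * (1 - w) ^+ 2 / w).
  by rewrite rmorphD phi2X fw; field.
have fm : phi (f - 2 *: 'X^(g.+1)) =
    phi (f + 2 *: 'X^(g.+1)) * ((1 + w) / (1 - w)) ^+ 2.
  by rewrite fp rmorphB phi2X fw; field; rewrite nw0.
have fp0 : phi (f + 2 *: 'X^(g.+1)) != 0.
  by rewrite fp oppr_eq0 !mulf_neq0 ?invr_eq0 ?expf_neq0.
have uw : y ^+ 2 / x ^+ d = w ^+ 2 by rewrite -XX expr_div_n.
rewrite fm symbolMr //; last by rewrite expf_neq0 // mulf_neq0 ?invr_eq0.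
by rewrite uw symbol_cayley // addr0.
Qed.

Lemma symbol_classes (g_ge1 : (1 <= g)%N)
    (t_simple_roots :
       forall z : algC, (mup z (map_poly ratr (t_poly d f)) <= 1)%N)
    (k : nat) (m : 'I_k -> {poly rat})
    (m_factors : irreducible_factors (t_poly d f) m) :
  exists M : 'I_k -> mod_torsion (K2T F),
    [/\ forall j : 'I_k,
          has_class (symbol (y ^+ 2 / x ^+ d) (phi (m j) / phi (m j).[0]%:P))
                    (M j),
        f.[0] = 1 \/ f.[0] = -1 ->
          exists2 MM : mod_torsion (K2T F),
            has_class (symbol (- phi f.[0]%:P * y) (- x)) MM &
            MM *+ (2 * d) = \sum_(j < k) M j
      & d = (2 * g + 2)%N ->
          forall l : nat, (l <= k)%N ->
          f - 2 *: 'X^(g.+1) = \prod_(j < k | (j < l)%N) m j ->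
          f + 2 *: 'X^(g.+1) = \prod_(j < k | (l <= j)%N) m j ->
          \sum_(j < k | (j < l)%N) M j = \sum_(j < k | (l <= j)%N) M j].
Proof.
have t0 := t_poly_neq0.
have t_sqf := simple_roots_squarefree t0 t_simple_roots.
have f0 := f_at0_neq0 t_sqf g_ge1.
have y0 : y != 0 := y_neq0.
pose u := y ^+ 2 / x ^+ d.
have u0 : u != 0 by rewrite mulf_neq0 ?invr_eq0 ?expf_neq0.
have t_at0 : (t_poly d f).[0] = 4^-1 * f.[0] ^+ 2.
  rewrite /t_poly !hornerE expr0n.
  by have [[-> _]|[-> _ _ _]] := C; rewrite ?addn1 ?addn2 gtn_eqF ?oppr0 ?add0r.
have t_at0_neq0 : (t_poly d f).[0] != 0 by rewrite t_at0 mulf_neq0 ?expf_neq0.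
have m_at0 j : (m j).[0] != 0.
  have [_ /(_ j)/dvdpP[q tE] _ _] := m_factors.
  by apply: contraNneq t_at0_neq0 => mj0; rewrite tE hornerM mj0 mulr0.
(* Value 1 at 0 is the normalisation under which [tame_y_poly] applies. *)
pose n j := (m j).[0]^-1 *: m j.
have n_at0 j : (n j).[0] = 1 by rewrite hornerZ mulVf.
have n_dvd j : n j %| t_poly d f.
  by rewrite dvdpZl ?invr_eq0 //; case: m_factors.
have nE j : phi (m j) / phi (m j).[0]%:P = phi (n j).
  apply: (canLR (mulfK _)); first by rewrite raddf_eq0 // polyC_eq0.
  by rewrite -rmorphM mulrC /n mul_polyC scalerA mulfV // scale1r.
have n0 j : phi (n j) != 0.
  rewrite raddf_eq0 //; apply: contra_eq_neq (n_at0 j) => ->.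
  by rewrite horner0 eq_sym oner_neq0.
have M_in j : symbol u (phi (n j)) \in @tame_kernel F.
  by apply: symbol_in_tame_kernel => // P; apply: (tame_y_poly f0).
have class_sum (Q : pred 'I_k) :
    \sum_(j | Q j) class_mod_torsion (MkK2T (M_in j)) =
    class_mod_torsion (\sum_(j | Q j) MkK2T (M_in j)) by rewrite raddf_sum.
have val_sum (Q : pred 'I_k) : K2Tval (\sum_(j | Q j) MkK2T (M_in j)) =
    symbol u (phi (\prod_(j | Q j) n j)).
  by rewrite raddf_sum rmorph_prod symbol_prodr.
exists (fun j => class_mod_torsion (MkK2T (M_in j))); split.
- by move=> j; exists (MkK2T (M_in j)) => //=; rewrite nE.
- move=> fs; have s_in : symbol (- phi f.[0]%:P * y) (- x) \in @tame_kernel F.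
    apply: symbol_in_tame_kernel => [||P].
    + by rewrite mulf_neq0 // oppr_eq0 raddf_eq0 // polyC_eq0.
    + by rewrite oppr_eq0.
    + exact: (tame_y_x f0).
  exists (class_mod_torsion (MkK2T s_in)); first by exists (MkK2T s_in).
  rewrite class_sum -raddfMn; apply: (@class_mod_torsion_eq _ _ _ 2) => //.
  apply: (val_inj : injective (@K2Tval F)); rewrite 3!raddfMn /= val_sum.
  rewrite (symbol_y_t fs); congr (symbol _ (phi _) *+ 2).
  (* Squarefreeness gives the product up to a constant; the values at 0, namely 1 and
     [f(0)^2 / 4 = 1/4], show that it is [4 t]. *)
  have : \prod_(j < k) n j %= t_poly d f.
    apply: eqp_trans (prod_irreducible_factors t0 t_sqf m_factors).
    rewrite /n scaler_prod eqp_scale //.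
    by apply/prodf_neq0 => j _; rewrite invr_eq0.
  case/eqpf_eq=> c c0 nt; rewrite nt; congr (_ *: _).
  have := congr1 (fun p : {poly rat} => p.[0]) nt.
  rewrite horner_prod big1 // hornerZ t_at0 => c4.
  have f2 : f.[0] ^+ 2 = 1 by case: fs => ->; rewrite ?sqrrN expr1n.
  by apply: (mulIf (_ : 4^-1 != 0)); rewrite // mulfV //; rewrite f2 mulr1 in c4.
- move=> dE l _ fm fp; rewrite !class_sum; congr class_mod_torsion.
  have X_at0 : ('X^(g.+1)).[0] = 0 :> rat by rewrite horner_exp hornerX expr0n.
  (* Both [f - 2 x^(g+1)] and [f + 2 x^(g+1)] have value [f(0)] at 0, so normalising their factors
     contributes the same term [{u, 1 / f(0)}] to each side. *)
  have symbol_prod (Q : pred 'I_k) p : p = \prod_(j | Q j) m j -> p.[0] = f.[0] ->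
      symbol u (phi (\prod_(j | Q j) n j)) =
      symbol u (phi f.[0]^-1%:P) + symbol u (phi p).
    move=> pE p_at0; have -> : \prod_(j | Q j) n j = f.[0]^-1%:P * p.
      by rewrite /n scaler_prod -pE prodfV -horner_prod -pE p_at0 mul_polyC.
    rewrite rmorphM symbolMr // raddf_eq0 ?polyC_eq0 ?invr_eq0 //.
    by apply: contraNneq f0 => p0; rewrite -p_at0 p0 horner0.
  apply: val_inj; rewrite /= !val_sum (symbol_prod _ _ fm) ?(symbol_prod _ _ fp).
  - by rewrite (symbol_y_split dE).
  - by rewrite hornerD hornerZ X_at0 mulr0 addr0.
  - by rewrite hornerD hornerN hornerZ X_at0 mulr0 subr0.
Qed.

End CurveFunctions.

(** * The function field of the curve *)

Section FunctionField.
Variables (g d : nat) (f : {poly rat}) (C : curve_shape g d f).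

Lemma fun_of_poly_is_zmod_morphism : zmod_morphism (fun_of_poly C).
Proof. by move=> p q; rewrite /fun_of_poly !rmorphB. Qed.

Lemma fun_of_poly_is_monoid_morphism : monoid_morphism (fun_of_poly C).
Proof.
split; first by rewrite /fun_of_poly !rmorph1.
by move=> p q; rewrite /fun_of_poly !rmorphM.
Qed.

HB.instance Definition _ := GRing.isZmodMorphism.Build
  {poly rat} (function_field C) (fun_of_poly C) fun_of_poly_is_zmod_morphism.
HB.instance Definition _ := GRing.isMonoidMorphism.Build
  {poly rat} (function_field C) (fun_of_poly C) fun_of_poly_is_monoid_morphism.

(** The class of a constant is represented by that constant, and [tofrac] is injective. *)
Lemma fun_of_poly_inj : injective (fun_of_poly C).
Proof.
move=> p q /(congr1 (fun a : function_field C => val a)) /= /polyC_inj /eqP.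
by rewrite tofrac_eq => /eqP.
Qed.

End FunctionField.

Theorem proposition6p14 (g d : nat) (f : {poly rat}) (g_ge1 : (1 <= g)%N)
    (C : curve_shape g d f)
    (t_simple_roots :
       forall z : algC, (mup z (map_poly ratr (t_poly d f)) <= 1)%N)
    (k : nat) (m : 'I_k -> {poly rat})
    (m_factors : irreducible_factors (t_poly d f) m) :
  let x := coord_x C in
  let y := coord_y C in
  let const (c : rat) := fun_of_poly C c%:P in
  exists M : 'I_k -> mod_torsion (K2T (function_field C)),
    [/\ forall j : 'I_k,
          has_class (symbol (y ^+ 2 / x ^+ d)
                            (fun_of_poly C (m j) / const (m j).[0]))
                    (M j),
        f.[0] = 1 \/ f.[0] = -1 ->
          exists2 MM : mod_torsion (K2T (function_field C)),
            has_class (symbol (- const f.[0] * y) (- x)) MM &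
            MM *+ (2 * d) = \sum_(j < k) M j
      & d = (2 * g + 2)%N ->
          forall l : nat, (l <= k)%N ->
          f - 2 *: 'X^(g.+1) = \prod_(j < k | (j < l)%N) m j ->
          f + 2 *: 'X^(g.+1) = \prod_(j < k | (l <= j)%N) m j ->
          \sum_(j < k | (j < l)%N) M j = \sum_(j < k | (l <= j)%N) M j].
Proof.
exact: (symbol_classes C (@fun_of_poly_inj _ _ _ C) (curve_equation C)).
Qed.
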